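(* Let $p$ be a prime and let $k,n$ be nonnegative integers. (1) If $p=3$, then $B_{3}(3^kn+3^k-1)=3^{2k}B_{3}(n)$. (2) If $p\equiv 1 \pmod 3$ and $p\nmid n+1$, then \[B_{3}(p^kn+p^k-1)=\frac{p^{2(k+1)}-1}{p^2-1}B_{3}(n).\] (3) If $p\equiv 2 \pmod 3$ and $p\nmid n+1$, then \[B_{3}(p^kn+p^k-1)=\frac{p^{2(k+1)}+(-1)^k}{p^2+1}B_{3}(n).\]
   Context: A partition $\lambda$ of a nonnegative integer is called a $3$-core if none of its hook lengths is divisible by $3$. $B_3(n)$ denotes the number of ordered triples $(\lambda_1,\lambda_2,\lambda_3)$ of partitions, each a $3$-core, whose sizes sum to $n$; equivalently $\sum_{n\ge0}B_3(n)q^n=\frac{(q^3;q^3)_\infty^{9}}{(q;q)_\infty^{3}}$, where $(a;q)_\infty=\prod_{k\ge0}(1-aq^k)$. *)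

(* Defs.v *)
From mathcomp Require Import all_boot all_order all_algebra.
Set Implicit Arguments. Unset Strict Implicit. Unset Printing Implicit Defensive.
Import GRing.Theory.
Local Open Scope ring_scope.

(* B3 n = coefficient of q^n in (q^3;q^3)_oo^9 / (q;q)_oo^3.
   Modulo q^(n+1), only the factors with index i+1 <= n matter, and
   1/(1-q^m) may be truncated to sum_{j<=n} q^(m j). *)
Definition B3_trunc (n : nat) : {poly int} :=
  \prod_(i < n)
     ((1 - 'X^(3 * i.+1)) ^+ 9 * (\sum_(j < n.+1) 'X^(i.+1 * j)) ^+ 3).

Definition B3 (n : nat) : int := (B3_trunc n)`_n.

(* Main.v *)
Require Import Defs.
From mathcomp Require Import all_boot all_order all_algebra.
From mathcomp Require Import ring zify.
Import GRing.Theory Num.Theory.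
Local Open Scope ring_scope.

(** Everything follows from [B3 n = sum_(d m = n + 1) d^2 chi(m)], where [chi]
    is the nontrivial character mod 3. Taking logarithmic derivatives of the
    product gives the recurrence [n B3(n) = sum_(1 <= j <= n) c(j) B3(n - j)],
    with [c(j) = sum_(d m = j) d (3 - 27 [3 | m])]. The divisor sum satisfies
    the same recurrence by Liouville's method: on the solutions of
    [a x + b y = N] the substitution [(a, b, x, y) -> (a, a + b, x - y, y)]
    carries the part [x > y] onto the part [a < b], and for a suitable form [G]
    the sum of [G] minus the sum of its transform [H] is twice the convolution
    occurring in the recurrence, so that only the diagonals [x = y] and [a = b]
    contribute. *)

(** * Reindexing of finite sums *)

Lemma sum_bij (A B : eqType) (s : seq A) (t : seq B) (f : A -> B) (g : B -> A)
    (F : B -> int) :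
  uniq s -> uniq t ->
  (forall x, x \in s -> f x \in t /\ g (f x) = x) ->
  (forall y, y \in t -> g y \in s /\ f (g y) = y) ->
  \sum_(x <- s) F (f x) = \sum_(y <- t) F y.
Proof.
move=> us ut fP gP; rewrite -(big_map f xpredT F); apply: perm_big.
apply: uniq_perm => //.
  by rewrite map_inj_in_uniq // => x y /fP[_ {2}<-] /fP[_ {2}<-] ->.
move=> y; apply/mapP/idP => [[x /fP[fx _] ->] //|/gP[gy fgy]].
by exists (g y).
Qed.

(** * The character mod 3 and the Liouville form *)

Definition chi3 (m : nat) : int :=
  if (m %% 3)%N == 1%N then 1 else if (m %% 3)%N == 2%N then -1 else 0.
(** The 3 is the exponent of the denominator [(q;q)]; the 27 is the exponent 9 times the 3 of
    [q^(3 i)]. *)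
Definition weight27 (m : nat) : int := 3 - (if (3 %| m)%N then 27 else 0).

Lemma mod3P (x : nat) : [\/ x %% 3 = 0, x %% 3 = 1 | x %% 3 = 2]%N.
Proof.
have := ltn_pmod x (isT : 0 < 3)%N.
by case: (x %% 3)%N => [|[|[|]]] // _; [constructor 1|constructor 2|constructor 3].
Qed.

Lemma chi3_mod (x : nat) : chi3 x = chi3 (x %% 3).
Proof. by rewrite /chi3 modn_mod. Qed.

Lemma chi3M (x y : nat) : chi3 (x * y) = chi3 x * chi3 y.
Proof.
rewrite (chi3_mod (x * y)) -modnMm (chi3_mod x) (chi3_mod y).
by case: (mod3P x) => ->; case: (mod3P y) => ->.
Qed.

(* The constants were found by solving the linear system that
   [liouville_imageE] and [liouville_form_sub_image] impose on the cubic forms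
   in [a, b] with coefficients depending on [x, y] mod 3. *)
Definition liouville_coef (x y : nat) : int :=
  chi3 (x + 2 * y) - 10 * chi3 (x + y) - 3 * chi3 x - chi3 y.
Definition liouville_form (a b : int) (x y : nat) : int :=
  - 2 * (a ^+ 3 * chi3 x + b ^+ 3 * chi3 y)
    + a ^+ 2 * b * liouville_coef x y + a * b ^+ 2 * liouville_coef y x.
(** [liouville_form] read through the inverse of [(a, b, x, y) -> (a, a + b, x - y, y)]. *)
Definition liouville_image (a b : int) (x y : nat) : int :=
  liouville_form a (b - a) (x + y) y.
Definition conv_form (a b : int) (x y : nat) : int :=
  a ^+ 2 * chi3 x * (b * weight27 y).

Lemma liouville_coef_mod x y : liouville_coef x y = liouville_coef (x %% 3) (y %% 3).
Proof.
rewrite /liouville_coef (chi3_mod (x + 2 * y)) (chi3_mod (x + y)).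
rewrite (chi3_mod x) (chi3_mod y).
rewrite (chi3_mod (x %% 3 + 2 * _)) (chi3_mod (x %% 3 + y %% 3)).
by rewrite modnDm modnDml -(modnDmr x (2 * (y %% 3))) modnMmr modnDmr.
Qed.

(** Reduces identities between forms to nine pairs of residues, each settled by [ring]. *)
Lemma liouville_form_mod a b x y :
  liouville_form a b x y = liouville_form a b (x %% 3) (y %% 3).
Proof.
rewrite /liouville_form (liouville_coef_mod x) (liouville_coef_mod y).
by rewrite (chi3_mod x) (chi3_mod y).
Qed.

(** The same image also arises from the mirror substitution [(a, b, x, y) -> (a + b, b, x, y - x)],
    so it serves the part [x < y] as well. *)
Lemma liouville_imageE a b x y :
  liouville_image a b x y = liouville_form (a - b) b x (x + y).
Proof.
rewrite /liouville_image (liouville_form_mod _ _ (x + y)).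
rewrite (liouville_form_mod _ _ x) -modnDm.
case: (mod3P x) => ->; case: (mod3P y) => ->;
  rewrite /liouville_form /liouville_coef /chi3 /=; ring.
Qed.

Lemma liouville_form_sub_image a b x y :
  liouville_form a b x y - liouville_image a b x y
  = conv_form a b x y + conv_form b a y x.
Proof.
rewrite /liouville_image (liouville_form_mod _ _ (x + y)).
rewrite (liouville_form_mod _ _ x) -modnDm.
rewrite /conv_form /weight27 /dvdn (chi3_mod x) (chi3_mod y).
case: (mod3P x) => ->; case: (mod3P y) => ->;
  rewrite /liouville_form /liouville_coef /chi3 /=; ring.
Qed.

(** * Factorizations of [N] and solutions of [a x + b y = N] *)

Definition square_pairs (N : nat) : seq (nat * nat) :=
  [seq (d, m) | d <- iota 1 N, m <- iota 1 N].
Definition divisor_pairs (N : nat) : seq (nat * nat) :=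
  [seq p <- square_pairs N | p.1 * p.2 == N]%N.
(* A solution of [a x + b y = N] is stored as [((a, x), (b, y))]. *)
Definition quads (N : nat) : seq ((nat * nat) * (nat * nat)) :=
  [seq q <- [seq (p, r) | p <- square_pairs N, r <- square_pairs N]
     | q.1.1 * q.1.2 + q.2.1 * q.2.2 == N]%N.

Lemma square_pairs_uniq N : uniq (square_pairs N).
Proof. by apply: allpairs_uniq; rewrite ?iota_uniq // => -[? ?] [? ?] _ _. Qed.

Lemma divisor_pairs_uniq N : uniq (divisor_pairs N).
Proof. exact/filter_uniq/square_pairs_uniq. Qed.

Lemma quads_uniq N : uniq (quads N).
Proof.
apply/filter_uniq/allpairs_uniq; rewrite ?square_pairs_uniq //.
by move=> [? ?] [? ?] _ _.
Qed.

Lemma mem_square_pairs N p :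
  (p \in square_pairs N) = (0 < p.1 <= N)%N && (0 < p.2 <= N)%N.
Proof.
have E k : (0 < k <= N)%N = (k \in iota 1 N) by rewrite mem_iota add1n ltnS.
case: p => d m /=; rewrite !E.
apply/allpairsP/andP => [[[d' m'] /= [h1 h2 [-> ->]]] //|[h1 h2]].
by exists (d, m).
Qed.

Lemma mem_divisor_pairs N p :
  (p \in divisor_pairs N) = [&& 0 < p.1, 0 < p.2 & p.1 * p.2 == N]%N.
Proof.
rewrite mem_filter mem_square_pairs; case: p => d m /=.
by apply/idP/idP; nia.
Qed.

Lemma mem_filter_divisor_pairs N P p : (p \in [seq r <- divisor_pairs N | P r]) =
  [&& P p, 0 < p.1, 0 < p.2 & p.1 * p.2 == N]%N.
Proof. by rewrite mem_filter mem_divisor_pairs. Qed.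

Lemma mem_quads N q : (q \in quads N) =
  [&& 0 < q.1.1, 0 < q.1.2, 0 < q.2.1, 0 < q.2.2
    & q.1.1 * q.1.2 + q.2.1 * q.2.2 == N]%N.
Proof.
rewrite mem_filter; case: q => -[a x] [b y] /=.
apply/andP/and5P => [[e /allpairsP[[[a' x'] [b' y']] /= [h1 h2 [? ? ? ?]]]]|].
  by subst; rewrite !mem_square_pairs /= in h1 h2; split=> //; lia.
case=> ha hx hb hy e; split=> //; apply/allpairsP; exists ((a, x), (b, y)).
by rewrite /= !mem_square_pairs /=; split=> //; nia.
Qed.

Lemma mem_filter_quads N P q : (q \in [seq r <- quads N | P r]) =
  P q && [&& 0 < q.1.1, 0 < q.1.2, 0 < q.2.1, 0 < q.2.2
    & q.1.1 * q.1.2 + q.2.1 * q.2.2 == N]%N.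
Proof. by rewrite mem_filter mem_quads. Qed.

(** * Liouville's transfer between solutions *)

Definition quad_eval (F : int -> int -> nat -> nat -> int)
    (q : (nat * nat) * (nat * nat)) :=
  F q.1.1%:Z q.2.1%:Z q.1.2 q.2.2.

Lemma sum_trichotomy (A : Type) (s : seq A) (u v : A -> nat) (F : A -> int) :
  \sum_(q <- s) F q = \sum_(q <- s | (v q < u q)%N) F q
    + \sum_(q <- s | (u q < v q)%N) F q + \sum_(q <- s | u q == v q) F q.
Proof.
rewrite (bigID (fun q => v q < u q)%N) /= -addrA; congr (_ + _).
rewrite (bigID (fun q => u q < v q)%N) /=; congr (_ + _); apply: eq_bigl => q; lia.
Qed.

(** The part [x > y] of the first sum matches the part [a < b] of the second, and [x < y] matches
    [b < a], each by its own substitution. *)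
Lemma quads_transfer N :
  \sum_(q <- quads N) quad_eval liouville_form q
    - \sum_(q <- quads N | q.1.2 == q.2.2) quad_eval liouville_form q
  = \sum_(q <- quads N) quad_eval liouville_image q
    - \sum_(q <- quads N | q.1.1 == q.2.1) quad_eval liouville_image q.
Proof.
rewrite (sum_trichotomy _ (quads N) (fun q => q.1.2) (fun q => q.2.2)) addrK.
(* Here [b] comes before [a], so that the parts line up in this order. *)
rewrite (sum_trichotomy _ (quads N) (fun q => q.2.1) (fun q => q.1.1)).
under [X in _ = _ - X]eq_bigl do rewrite eq_sym.
rewrite addrK; congr (_ + _).
- rewrite -big_filter -[RHS]big_filter.
  pose f (q : (nat * nat) * (nat * nat)) :=
    ((q.1.1, q.1.2 - q.2.2), (q.1.1 + q.2.1, q.2.2))%N.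
  pose g (q : (nat * nat) * (nat * nat)) :=
    ((q.1.1, q.1.2 + q.2.2), (q.2.1 - q.1.1, q.2.2))%N.
  transitivity (\sum_(q <- [seq q <- quads N | q.2.2 < q.1.2]%N)
    quad_eval liouville_image (f q)); last first.
    apply: (sum_bij _ _ _ _ f g).
    + exact/filter_uniq/quads_uniq.
    + exact/filter_uniq/quads_uniq.
    + move=> [[a x] [b y]]; rewrite !mem_filter_quads /f /g /= => h.
      by split; [nia | congr ((_, _), (_, _)); lia].
    + move=> [[a x] [b y]]; rewrite !mem_filter_quads /f /g /= => h.
      by split; [nia | congr ((_, _), (_, _)); lia].
  rewrite !big_filter; apply: eq_bigr => -[[a x] [b y]] /= lt.
  rewrite /quad_eval /f /liouville_image /=.
  by rewrite subnK ?(ltnW lt) // PoszD addrAC subrr add0r.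
- rewrite -big_filter -[RHS]big_filter.
  pose f (q : (nat * nat) * (nat * nat)) :=
    ((q.1.1 + q.2.1, q.1.2), (q.2.1, q.2.2 - q.1.2))%N.
  pose g (q : (nat * nat) * (nat * nat)) :=
    ((q.1.1 - q.2.1, q.1.2), (q.2.1, q.1.2 + q.2.2))%N.
  transitivity (\sum_(q <- [seq q <- quads N | q.1.2 < q.2.2]%N)
    quad_eval liouville_image (f q)); last first.
    apply: (sum_bij _ _ _ _ f g).
    + exact/filter_uniq/quads_uniq.
    + exact/filter_uniq/quads_uniq.
    + move=> [[a x] [b y]]; rewrite !mem_filter_quads /f /g /= => h.
      by split; [nia | congr ((_, _), (_, _)); lia].
    + move=> [[a x] [b y]]; rewrite !mem_filter_quads /f /g /= => h.
      by split; [nia | congr ((_, _), (_, _)); lia].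
  rewrite !big_filter; apply: eq_bigr => -[[a x] [b y]] /= lt.
  rewrite /quad_eval /f liouville_imageE /=.
  by rewrite subnKC ?(ltnW lt) // PoszD addrK.
Qed.

Lemma quads_swap N (F : int -> int -> nat -> nat -> int) :
  \sum_(q <- quads N) quad_eval F q
  = \sum_(q <- quads N) quad_eval (fun a b x y => F b a y x) q.
Proof.
pose f (q : (nat * nat) * (nat * nat)) := (q.2, q.1).
rewrite -(sum_bij _ _ _ _ f f (quad_eval F) (quads_uniq N) (quads_uniq N)) //;
 by move=> [[a x] [b y]]; rewrite !mem_quads /f /= => h; split=> //; lia.
Qed.

Lemma sum_bij_dep (I J K : eqType) (s : seq I) (t : I -> seq J) (r : seq K)
    (f : I -> J -> K) (g : K -> I * J) (F : K -> int) :
  uniq s -> (forall i, uniq (t i)) -> uniq r ->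
  (forall i j, i \in s -> j \in t i -> f i j \in r /\ g (f i j) = (i, j)) ->
  (forall k, k \in r ->
     [/\ (g k).1 \in s, (g k).2 \in t (g k).1 & f (g k).1 (g k).2 = k]) ->
  \sum_(i <- s) \sum_(j <- t i) F (f i j) = \sum_(k <- r) F k.
Proof.
move=> us ut ur fP gP.
rewrite -(sum_bij _ _ [seq (i, j) | i <- s, j <- t i] r (uncurry f) g) //.
- by rewrite big_allpairs_dep.
- by apply: allpairs_uniq_dep => // -[i j] [i' j'] _ _ /= [-> ->].
- by move=> _ /allpairsPdep[i [j [si tj ->]]]; apply: fP.
- move=> k /gP[gs gt fg]; split; last by case: (g k) fg.
  by case: (g k) gs gt => i j /= si tj; apply: allpairs_f_dep.
Qed.

(** * The recurrence for the divisor sum *)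

Definition chi_sigma2 (N : nat) : int :=
  \sum_(p <- divisor_pairs N) p.1%:Z ^+ 2 * chi3 p.2.
Definition log_coef (N : nat) : int :=
  \sum_(p <- divisor_pairs N) p.1%:Z * weight27 p.2.

(** Sorting the solutions by [j = b y] leaves a factorization of [j] and one of [N - j]. *)
Lemma quads_conv N :
  \sum_(q <- quads N) quad_eval conv_form q
  = \sum_(1 <= j < N) log_coef j * chi_sigma2 (N - j).
Proof.
pose t j := [seq (p, r) | p <- divisor_pairs j, r <- divisor_pairs (N - j)].
rewrite -(sum_bij_dep _ _ _ (index_iota 1 N) t (quads N) (fun _ z => (z.2, z.1))
  (fun q => ((q.2.1 * q.2.2)%N, (q.2, q.1)))).
- apply: eq_bigr => j _; rewrite big_allpairs mulr_suml; apply: eq_bigr => p _.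
  rewrite mulr_sumr; apply: eq_bigr => r _; rewrite /quad_eval /conv_form /=; ring.
- exact: iota_uniq.
- by move=> j; apply: allpairs_uniq; rewrite ?divisor_pairs_uniq // => -[? ?] [? ?] _ _.
- exact: quads_uniq.
- move=> j z; rewrite mem_index_iota => jN /allpairsP[[p r] /= [hp hr ->]] /=.
  move: hp hr; rewrite !mem_divisor_pairs mem_quads /=.
  move=> /and3P[p1 p2 /eqP ep] /and3P[r1 r2 /eqP er].
  by rewrite ep; split=> //; apply/and5P; split=> //; lia.
- case=> p r; rewrite mem_quads mem_index_iota /= => /and5P[p1 p2 r1 r2 /eqP e].
  split=> //; first nia.
  by apply/allpairsP; exists (r, p); rewrite !mem_divisor_pairs /=; split=> //; lia.
Qed.

Lemma sum_form_diag (c x : nat) : (0 < c)%N ->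
  \sum_(1 <= a < c) liouville_form a (c - a)%N x x = 2 * (c%:Z ^+ 3 - c%:Z ^+ 2) * chi3 x.
Proof.
move=> c0.
have formE a : (a < c)%N ->
    liouville_form a (c - a)%N x x
    = chi3 x * (12 * c%:Z * (a%:Z * (c%:Z - a%:Z)) - 2 * c%:Z ^+ 3).
  move=> ac; rewrite -subzn 1?ltnW // liouville_form_mod (chi3_mod x).
  by case: (mod3P x) => ->;
  rewrite /liouville_form /liouville_coef /chi3 /=; ring.
(* The bound [n] is kept apart from [c] to allow induction; it is used at [n = c - 1]. *)
have sumE n : \sum_(1 <= a < n.+1) (12 * c%:Z * (a%:Z * (c%:Z - a%:Z)) - 2 * c%:Z ^+ 3)
    = n%:Z * (6 * c%:Z ^+ 2 * (n%:Z + 1)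
        - 2 * c%:Z * (n%:Z + 1) * (2 * n%:Z + 1) - 2 * c%:Z ^+ 3).
  elim: n => [|n IH]; first by rewrite big_geq // mul0r.
  by rewrite big_nat_recr //= IH -[n.+1]addn1 PoszD; ring.
under eq_big_nat => a /andP[_ ac] do rewrite formE //.
rewrite -mulr_sumr; case: c c0 {formE} sumE => // c _ ->.
by rewrite -[c.+1]addn1 PoszD; ring.
Qed.

(** With [x = y] the equation becomes [(a + b) x = N]: a factorization [(c, x)] and a splitting of
    [c]. *)
Lemma quads_diag_form N : \sum_(q <- quads N | q.1.2 == q.2.2) quad_eval liouville_form q
  = \sum_(p <- divisor_pairs N) 2 * (p.1%:Z ^+ 3 - p.1%:Z ^+ 2) * chi3 p.2.
Proof.
rewrite -big_filter -(sum_bij_dep _ _ _ (divisor_pairs N) (fun p => index_iota 1 p.1) _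
  (fun p a => ((a, p.2), ((p.1 - a)%N, p.2)))
  (fun q => ((q.1.1 + q.2.1, q.1.2), q.1.1)%N)).
- apply: eq_big_seq => p; rewrite mem_divisor_pairs => /andP[p1 _].
  exact: sum_form_diag.
- exact: divisor_pairs_uniq.
- by move=> p; apply: iota_uniq.
- exact/filter_uniq/quads_uniq.
- move=> [c x] a; rewrite mem_divisor_pairs mem_index_iota mem_filter_quads /= => h1 h2.
  by split; [nia | congr ((_, _), _); lia].
- move=> [[a x] [b y]]; rewrite mem_filter_quads mem_divisor_pairs mem_index_iota /= => h.
  by split; [nia | lia | congr ((_, _), (_, _)); lia].
Qed.

(** With [a = b] the second argument of the form vanishes; what remains depends only on [a] and
    [m = x + y], and [m] splits in [m - 1] ways. *)
Lemma quads_diag_image N :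
  \sum_(q <- quads N | q.1.1 == q.2.1) quad_eval liouville_image q
  = \sum_(p <- divisor_pairs N) - 2 * p.1%:Z ^+ 3 * chi3 p.2 * (p.2%:Z - 1).
Proof.
rewrite -big_filter -(sum_bij_dep _ _ _ (divisor_pairs N) (fun p => index_iota 1 p.2) _
  (fun p x => ((p.1, x), (p.1, (p.2 - x)%N)))
  (fun q => ((q.1.1, q.1.2 + q.2.2), q.1.2)%N)).
- apply: eq_big_seq => -[a m]; rewrite mem_divisor_pairs => /and3P[_ m1 _] /=.
  rewrite (eq_big_nat _ _ (F2 := fun=> - 2 * a%:Z ^+ 3 * chi3 m)); last first.
    move=> x /andP[_ xm]; rewrite /quad_eval /liouville_image /= subnKC 1?ltnW //.
    rewrite /liouville_form; ring.
  rewrite sumr_const_nat -[LHS]mulr_natr; congr (_ * _).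
  by rewrite natz -subzn.
- exact: divisor_pairs_uniq.
- by move=> p; apply: iota_uniq.
- exact/filter_uniq/quads_uniq.
- move=> [a m] x; rewrite mem_divisor_pairs mem_index_iota mem_filter_quads /= => h1 h2.
  by split; [nia | congr ((_, _), _); lia].
- move=> [[a x] [b y]]; rewrite mem_filter_quads mem_divisor_pairs mem_index_iota /= => h.
  by split; [nia | lia | congr ((_, _), (_, _)); lia].
Qed.

Lemma chi_sigma2_rec N :
  (N%:Z - 1) * chi_sigma2 N = \sum_(1 <= j < N) log_coef j * chi_sigma2 (N - j).
Proof.
rewrite -quads_conv; apply: (mulfI (x := 2)) => //.
transitivity (\sum_(q <- quads N) quad_eval liouville_form q
              - \sum_(q <- quads N) quad_eval liouville_image q); last first.
  rewrite -sumrB mulr_natl mulr2n {2}quads_swap -big_split /=.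
  by apply: eq_bigr => q _; rewrite /quad_eval -liouville_form_sub_image.
transitivity (\sum_(q <- quads N | q.1.2 == q.2.2) quad_eval liouville_form q
              - \sum_(q <- quads N | q.1.1 == q.2.1) quad_eval liouville_image q); last first.
  have := quads_transfer N; lia.
(* For [d m = N] the diagonals add up to [2 (d^3 - d^2) + 2 d^3 (m - 1) = 2 d^2 (N - 1)], times
   [chi3 m]. *)
rewrite quads_diag_form quads_diag_image -sumrB /chi_sigma2 !mulr_sumr.
apply: eq_big_seq => p; rewrite mem_divisor_pairs => /and3P[_ _ /eqP <-].
rewrite PoszM; ring.
Qed.

(** * Congruence of polynomials modulo a power of ['X] *)

Definition eqX (M : nat) (p q : {poly int}) := exists r, p = q + 'X^M * r.

Lemma eqX_refl M p : eqX M p p.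
Proof. by exists 0; rewrite mulr0 addr0. Qed.

Lemma eqX_trans M p q r : eqX M p q -> eqX M q r -> eqX M p r.
Proof. by case=> [a ->] [b ->]; exists (b + a); rewrite mulrDr addrA. Qed.

Lemma eqXM M p q p' q' : eqX M p q -> eqX M p' q' -> eqX M (p * p') (q * q').
Proof.
by case=> [a ->] [b ->]; exists (q * b + a * q' + 'X^M * a * b); ring.
Qed.

Lemma eqX_exp M p q n : eqX M p q -> eqX M (p ^+ n) (q ^+ n).
Proof.
move=> pq; elim: n => [|n IH]; first exact: eqX_refl.
by rewrite !exprS; apply: eqXM.
Qed.

Lemma eqX_coef M p q k : eqX M p q -> (k < M)%N -> p`_k = q`_k.
Proof. by case=> r -> kM; rewrite coefD coefXnM kM addr0. Qed.

Lemma eqX_Xn M k p : (M <= k)%N -> eqX M (p + 'X^k) p.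
Proof. by move=> Mk; exists 'X^(k - M); rewrite -exprD subnKC. Qed.

Lemma eqX_subXn M k p : (M <= k)%N -> eqX M (p - 'X^k) p.
Proof. by move=> Mk; exists (- 'X^(k - M)); rewrite mulrN -exprD subnKC. Qed.

(** * The truncated product and its stability *)

Definition geom (n i : nat) : {poly int} := \sum_(j < n.+1) 'X^(i * j).
Definition B3_factor (n i : nat) : {poly int} := (1 - 'X^(3 * i)) ^+ 9 * geom n i ^+ 3.
Definition B3_product (m n : nat) : {poly int} := \prod_(i < m) B3_factor n i.+1.

Lemma geom_recr n i : geom n.+1 i = geom n i + 'X^(i * n.+1).
Proof. by rewrite /geom big_ord_recr. Qed.

Lemma geomE n i : (1 - 'X^i) * geom n i = 1 - 'X^(i * n.+1).
Proof.
elim: n => [|n IH]; first by rewrite /geom big_ord1 muln0 muln1 expr0 mulr1.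
by rewrite geom_recr mulrDr IH mulrBl mul1r -exprD -mulnS; ring.
Qed.

Lemma coef_Xgeom n i k : (0 < i)%N -> (k <= n)%N ->
  ('X^i * geom n i)`_k = ((0 < k) && (i %| k))%N%:R.
Proof.
move=> i0 kn; rewrite /geom mulr_sumr coef_sum.
under eq_bigr => j _ do rewrite -exprD -mulnS coefXn.
case: (boolP ((0 < k) && (i %| k))%N) => [/andP[k0 /dvdnP[d dk]]|nk].
  have dE : d.-1.+1 = d by case: d dk k0 => // ->.
  (* The exponent [k = d i] comes from the index [d - 1], because of the extra factor ['X^i]. *)
  have dn : (d.-1 < n.+1)%N by rewrite dE; nia.
  rewrite (bigD1 (Ordinal dn)) //= big1 ?addr0 => [|j jd].
    by rewrite dE dk mulnC eqxx.
  case: eqP => // e; case/eqP: jd; apply: val_inj => /=; nia.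
rewrite big1 // => j _; case: eqP => // e; case/negP: nk.
by rewrite e dvdn_mulr // andbT muln_gt0 i0.
Qed.

Lemma B3_product_recr m n : B3_product m.+1 n = B3_product m n * B3_factor n m.+1.
Proof. by rewrite /B3_product big_ord_recr. Qed.

Lemma B3_factor_eqX1 n i : eqX i (B3_factor n i) 1.
Proof.
have E : 1 = (1 ^+ 9 * 1 ^+ 3 :> {poly int}) by rewrite !expr1n mul1r.
rewrite /B3_factor [X in eqX _ _ X]E; apply/eqXM/eqX_exp.
  exact/eqX_exp/eqX_subXn/leq_pmull.
elim: n => [|n IH]; first by rewrite /geom big_ord1 muln0; apply: eqX_refl.
by rewrite geom_recr; apply: eqX_trans IH; apply/eqX_Xn/leq_pmulr.
Qed.

Lemma B3_factor_stable n i : (0 < i)%N -> eqX n.+1 (B3_factor n.+1 i) (B3_factor n i).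
Proof.
move=> i0; apply/eqXM/eqX_exp; first exact: eqX_refl.
by rewrite geom_recr; apply/eqX_Xn/leq_pmull.
Qed.

(** The new factor is 1 to this order, and the longer geometric sums differ only in degrees above
    [n]. *)
Lemma B3_product_stable n : eqX n.+1 (B3_product n.+1 n.+1) (B3_product n n).
Proof.
rewrite B3_product_recr -[B3_product n n]mulr1; apply: eqXM; last exact: B3_factor_eqX1.
(* Only the number of factors varies; the truncation order stays fixed. *)
elim: {2 4}n => [|m IH]; first by rewrite /B3_product !big_ord0; apply: eqX_refl.
by rewrite !B3_product_recr; apply: eqXM => //; apply: B3_factor_stable.
Qed.

Lemma B3E_product n : B3 n = (B3_product n n)`_n.
Proof. by []. Qed.

(** Each [B3 k] has its own truncation; this lets a single product supply all values up to [n]. *)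
Lemma coef_B3_product n k : (k <= n)%N -> (B3_product n n)`_k = B3 k.
Proof.
move=> kn; rewrite -(subnK kn); elim: (n - k)%N => [//|d IH].
by rewrite addSn (eqX_coef _ _ _ _ (B3_product_stable _)) // ltnS leq_addl.
Qed.

(** * Logarithmic derivative and the recurrence for [B3] *)

Definition theta (p : {poly int}) : {poly int} := 'X * p^`().
(* [geom n i] is [1 / (1 - 'X^i)] modulo ['X^n.+1], so this is the logarithmic
   derivative of [B3_factor n i] to that order. *)
Definition log_deriv (n i : nat) : {poly int} :=
  ('X^i * geom n i) *+ (3 * i) - ('X^(3 * i) * geom n (3 * i)) *+ (27 * i).

Lemma thetaXn k : theta 'X^k = 'X^k *+ k.
Proof. by rewrite /theta derivXn mulrnAr; case: k => [|k]; rewrite ?mulr0n -?exprS. Qed.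

Lemma thetaM p q : theta (p * q) = theta p * q + p * theta q.
Proof. rewrite /theta derivM; ring. Qed.

Lemma theta_exp p n : theta (p ^+ n) = theta p * p ^+ n.-1 *+ n.
Proof. by rewrite /theta deriv_exp mulrnAr mulrA. Qed.

Lemma theta1BXn k : theta (1 - 'X^k) = - ('X^k *+ k).
Proof. by rewrite -thetaXn /theta derivB derivC sub0r mulrN. Qed.

(** Integer polynomials do not allow division by [1 - 'X^i], so [geom n i] acts as its inverse and
    the errors, multiples of ['X^(n.+1)], are carried explicitly. *)
Lemma theta_B3_factor n i : (0 < i)%N ->
  eqX n.+1 (theta (B3_factor n i)) (B3_factor n i * log_deriv n i).
Proof.
move=> i0; have E := geomE n i; have E3 := geomE n (3 * i).
have T := congr1 theta E; rewrite thetaM !theta1BXn in T.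
pose e k : {poly int} := 'X^(k * n.+1 - n.+1).
have eE k : (0 < k)%N -> 'X^(k * n.+1) = 'X^(n.+1) * e k.
  by move=> k0; rewrite /e -exprD subnKC // leq_pmull.
rewrite !eE ?muln_gt0 // in E E3 T.
have V : theta (geom n i) = 'X^i * geom n i ^+ 2 *+ i
    + 'X^(n.+1) * e i * (theta (geom n i) - geom n i *+ (i * n.+1)).
  (* Multiplying [T] by [geom n i] and replacing [(1 - 'X^i) * geom n i] through [E] solves for
     [theta (geom n i)]. *)
  suff : geom n i * (- ('X^i *+ i) * geom n i + (1 - 'X^i) * theta (geom n i))
      - geom n i * - ('X^(n.+1) * e i *+ (i * n.+1))
      + theta (geom n i) * ((1 - 'X^(n.+1) * e i) - (1 - 'X^i) * geom n i) = 0.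
    move=> Z; rewrite -[LHS]subr0 -Z; ring.
  by rewrite E T; ring.
move: V; set z := theta (geom n i) - _ => V.
(* The first term is the error of [E3], the second that of [V] in the derivative of the cube. *)
exists (27%:R * i%:R * 'X^(3 * i) * (1 - 'X^(3 * i)) ^+ 8 * geom n i ^+ 3
    * (- e (3 * i)%N)
  + 3%:R * (1 - 'X^(3 * i)) ^+ 9 * geom n i ^+ 2 * (e i * z)).
rewrite /B3_factor thetaM !theta_exp theta1BXn V /log_deriv.
(* One factor is split off the ninth power to meet [geom n (3 * i)], so that [E3] applies. *)
have -> : (1 - 'X^(3 * i)) ^+ 9 * geom n i ^+ 3 *
   ('X^i * geom n i *+ (3 * i) - 'X^(3 * i) * geom n (3 * i) *+ (27 * i))
 = (1 - 'X^(3 * i)) ^+ 9 * geom n i ^+ 3 * ('X^i * geom n i *+ (3 * i))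
   - (1 - 'X^(3 * i)) ^+ 8 * geom n i ^+ 3 * 'X^(3 * i)
      * ((1 - 'X^(3 * i)) * geom n (3 * i)) *+ (27 * i) :> {poly int}.
  ring.
rewrite E3 /=; ring.
Qed.

Lemma theta_B3_product m n :
  eqX n.+1 (theta (B3_product m n)) (B3_product m n * \sum_(i < m) log_deriv n i.+1).
Proof.
elim: m => [|m [r IH]].
  by rewrite /B3_product !big_ord0 mulr0 /theta derivC mulr0; apply: eqX_refl.
have [s F] := theta_B3_factor n _ (ltn0Sn m).
exists (r * B3_factor n m.+1 + B3_product m n * s).
rewrite B3_product_recr big_ord_recr thetaM IH F /=; ring.
Qed.

Lemma coef_log_deriv n k : (k <= n)%N ->
  (\sum_(i < n) log_deriv n i.+1)`_k = if k is 0 then 0 else log_coef k.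
Proof.
move=> kn; rewrite coef_sum.
under eq_bigr => i _ do rewrite /log_deriv coefB !coefMn !coef_Xgeom ?muln_gt0 //.
case: k kn => [|k] kn.
  by rewrite big1 // => i _; rewrite !mul0rn subr0.
rewrite /log_coef; set K := k.+1.
(* A factorization of [K] is determined by its first entry, which is at most [K <= n]. *)
transitivity (\sum_(i <- [seq i <- iota 1 n | i %| K]%N)
  i%:Z * weight27 (K %/ i)); last first.
  apply: (sum_bij _ _ _ _ (fun i => (i, (K %/ i)%N)) fst
    (fun p => p.1%:Z * weight27 p.2)).
  - exact/filter_uniq/iota_uniq.
  - exact: divisor_pairs_uniq.
  - move=> i; rewrite mem_divisor_pairs mem_filter mem_iota /= => /andP[iK /andP[i0 _]].
    by rewrite i0 divn_gt0 // dvdn_leq //= mulnC divnK.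
  - case=> d m; rewrite mem_divisor_pairs mem_filter mem_iota /= => /and3P[d0 m0 /eqP e].
    rewrite -e dvdn_mulr // mulKn //; split=> //; rewrite d0 /=.
    by rewrite -[k.+1]/K -e in kn; nia.
rewrite big_filter (_ : iota 1 n = index_iota 1 n.+1); last by rewrite /index_iota subn1.
rewrite big_add1 big_mkord.
rewrite [RHS]big_mkcond; apply: eq_bigr => i _ /=.
rewrite /weight27; case: ifP => iK.
  by rewrite dvdn_divRL //; case: ifP => _ /=; lia.
have -> : (3 * i.+1 %| K)%N = false.
  by apply/negP => /(dvdn_trans (dvdn_mull 3 (dvdnn i.+1))); rewrite iK.
by rewrite !mul0rn subr0.
Qed.

Lemma B3_rec n : n%:Z * B3 n = \sum_(1 <= j < n.+1) log_coef j * B3 (n - j).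
Proof.
transitivity ((theta (B3_product n n))`_n).
  rewrite /theta coefXM coef_deriv B3E_product.
  case: n => [|n] /=; first by rewrite mul0r.
  by rewrite -natz mulr_natl.
rewrite (eqX_coef _ _ _ _ (theta_B3_product n n)) // coefMr big_ord_recl.
(* The logarithmic derivative has no constant term, so the convolution starts at [j = 1]. *)
rewrite coef_log_deriv // mulr0 add0r big_add1 big_mkord; apply: eq_bigr => j _.
by rewrite coef_log_deriv ?ltn_ord // coef_B3_product ?leq_subr // mulrC.
Qed.

Lemma B3_chi_sigma2 n : B3 n = chi_sigma2 n.+1.
Proof.
elim/ltn_ind: n => -[_|n IH].
  rewrite /B3 /B3_trunc big_ord0 coef1 /chi_sigma2.
  by rewrite (_ : divisor_pairs 1 = [:: (1, 1)]%N) // big_seq1.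
apply: (mulfI (x := n.+1%:Z)) => //.
(* At [N = n + 2] the factor [N - 1] is the factor [n + 1] of the recurrence for [B3]. *)
rewrite B3_rec; have := chi_sigma2_rec n.+2.
rewrite -[X in X%:Z - 1]addn1 PoszD addrK => ->.
apply: eq_big_nat => j /andP[j1 jn]; rewrite IH; last lia.
by rewrite -subSn.
Qed.

(** * The divisor sum at multiples of a prime *)

Definition chi_sigma2_coprime (p N : nat) : int :=
  \sum_(q <- divisor_pairs N | ~~ (p %| q.1)%N) q.1%:Z ^+ 2 * chi3 q.2.

Lemma chi_sigma2_coprimeE p N : ~~ (p %| N)%N -> chi_sigma2_coprime p N = chi_sigma2 N.
Proof.
move=> pN; rewrite /chi_sigma2_coprime big_seq_cond [RHS]big_seq_cond.
apply: eq_bigl => q.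
rewrite mem_divisor_pairs andbT; case: and3P => //= -[_ _ /eqP e].
by apply/negP => pq; rewrite -e dvdn_mulr in pN.
Qed.

(** If [d m = p N] and [p] does not divide [d], then [p] divides [m], and [chi3] releases the factor
    [chi3 p]. *)
Lemma chi_sigma2_coprime_mul p N : prime p ->
  chi_sigma2_coprime p (p * N) = chi3 p * chi_sigma2_coprime p N.
Proof.
move=> pr; have p0 := prime_gt0 pr.
rewrite /chi_sigma2_coprime mulr_sumr -big_filter -[RHS]big_filter.
transitivity (\sum_(q <- [seq q <- divisor_pairs N | ~~ (p %| q.1)%N])
   q.1%:Z ^+ 2 * chi3 (p * q.2)); last first.
  by apply: eq_bigr => q _; rewrite chi3M; ring.
symmetry; apply: (sum_bij _ _ _ _ (fun q => (q.1, p * q.2)%N)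
  (fun q => (q.1, q.2 %/ p)%N) (fun q => q.1%:Z ^+ 2 * chi3 q.2)).
- exact/filter_uniq/divisor_pairs_uniq.
- exact/filter_uniq/divisor_pairs_uniq.
- move=> [d m]; rewrite !mem_filter_divisor_pairs /= => /andP[-> h] /=.
  by rewrite mulKn //; split=> //; nia.
- move=> [d m]; rewrite !mem_filter_divisor_pairs /=.
  move=> /and4P[pd d0 m0 /eqP e].
  have pm : (p %| m)%N.
    by have := dvdn_mulr N (dvdnn p); rewrite -e Euclid_dvdM // (negbTE pd).
  have -> : (p * (m %/ p) = m)%N by rewrite mulnC divnK.
  rewrite pd d0 divn_gt0 // dvdn_leq //=; split=> //.
  by rewrite -(eqn_pmul2l p0) -e mulnCA [(p * (m %/ p))%N]mulnC divnK.
Qed.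

(** The divisors [d = p d'] give the first term, the remaining ones the second. *)
Lemma chi_sigma2_mul p N : prime p ->
  chi_sigma2 (p * N) = p%:Z ^+ 2 * chi_sigma2 N + chi3 p * chi_sigma2_coprime p N.
Proof.
move=> pr; have p0 := prime_gt0 pr.
rewrite -chi_sigma2_coprime_mul // /chi_sigma2 (bigID (fun q => p %| q.1)%N) /=.
congr (_ + _).
rewrite mulr_sumr -big_filter.
transitivity (\sum_(q <- divisor_pairs N) (p * q.1)%N%:Z ^+ 2 * chi3 q.2); last first.
  by apply: eq_bigr => q _; rewrite PoszM; ring.
symmetry; apply: (sum_bij _ _ _ _ (fun q => (p * q.1, q.2)%N)
  (fun q => (q.1 %/ p, q.2)%N) (fun q => q.1%:Z ^+ 2 * chi3 q.2)).
- exact/divisor_pairs_uniq.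
- exact/filter_uniq/divisor_pairs_uniq.
- move=> [d m]; rewrite mem_divisor_pairs mem_filter_divisor_pairs /= => h.
  by rewrite mulKn // dvdn_mulr //=; split=> //; nia.
- move=> [d m]; rewrite mem_divisor_pairs mem_filter_divisor_pairs /=.
  move=> /and4P[pd d0 m0 /eqP e].
  have -> : (p * (d %/ p) = d)%N by rewrite mulnC divnK.
  rewrite m0 divn_gt0 // dvdn_leq //=; split=> //.
  by rewrite -(eqn_pmul2l p0) -e mulnA [(p * (d %/ p))%N]mulnC divnK.
Qed.

Lemma chi_sigma2_coprime_exp p k N : prime p ->
  chi_sigma2_coprime p (p ^ k * N) = chi3 p ^+ k * chi_sigma2_coprime p N.
Proof.
move=> pr; elim: k => [|k IH]; first by rewrite mul1n mul1r.
by rewrite expnS -mulnA chi_sigma2_coprime_mul // IH exprS mulrA.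
Qed.

(** A first-order recurrence in [k], whose solutions are the quotients in the theorem. *)
Lemma chi_sigma2_expS p k N : prime p -> ~~ (p %| N)%N ->
  chi_sigma2 (p ^ k.+1 * N)
  = p%:Z ^+ 2 * chi_sigma2 (p ^ k * N) + chi3 p ^+ k.+1 * chi_sigma2 N.
Proof.
move=> pr pN.
rewrite expnS -mulnA chi_sigma2_mul // chi_sigma2_coprime_exp //.
by rewrite chi_sigma2_coprimeE // [chi3 p ^+ k.+1]exprS mulrA.
Qed.

(** * The three congruence cases *)

Lemma B3_index p k n : (0 < p)%N ->
  B3 (p ^ k * n + p ^ k - 1) = chi_sigma2 (p ^ k * n.+1).
Proof.
move=> p0; have : (0 < p ^ k)%N by rewrite expn_gt0 p0.
by move: (p ^ k)%N => q q0; rewrite B3_chi_sigma2 mulnS; congr (chi_sigma2 _); lia.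
Qed.

Theorem theorem3p4 (p k n : nat) : prime p ->
  (p = 3%N ->
     B3 (3 ^ k * n + 3 ^ k - 1)%N = (3 ^ (2 * k))%N%:Z * B3 n) /\
  ((p %% 3)%N = 1%N -> ~~ (p %| n.+1)%N ->
     (B3 (p ^ k * n + p ^ k - 1)%N)%:~R
       = ((p%:R ^+ (2 * k.+1)%N - 1) / (p%:R ^+ 2 - 1)) * (B3 n)%:~R :> rat) /\
  ((p %% 3)%N = 2%N -> ~~ (p %| n.+1)%N ->
     (B3 (p ^ k * n + p ^ k - 1)%N)%:~R
       = ((p%:R ^+ (2 * k.+1)%N + (-1) ^+ k) / (p%:R ^+ 2 + 1)) * (B3 n)%:~R :> rat).
Proof.
move=> pr; have p0 := prime_gt0 pr; have p1 := prime_gt1 pr.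
rewrite !B3_index // B3_chi_sigma2; split; last split.
- move=> _; elim: k => [|k IH]; first by rewrite mul1n mul1r.
  (* Since [chi3 3 = 0], each step only multiplies by [3^2]. *)
  rewrite expnS -mulnA chi_sigma2_mul // IH (_ : chi3 3 = 0) // mul0r addr0.
  by rewrite mulnS expnD PoszM mulrA.
- move=> pm pn; have p21 : p%:R ^+ 2 - 1 != 0 :> rat.
    by rewrite subr_eq0 -natrX -[1]/(1%:R) eqr_nat; nia.
  elim: k => [|k IH]; first by rewrite mul1n muln1 divff // mul1r.
  rewrite chi_sigma2_expS // rmorphD (rmorphM _ (p%:Z ^+ 2)) (rmorphM _ (chi3 p ^+ _)).
  rewrite !rmorphXn /=.
  (* Here [chi3 p = 1], so each step adds one copy of the value at [k = 0]. *)
  rewrite IH {1}/chi3 pm /= expr1n.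
  rewrite [(2 * k.+2)%N]mulnS exprD -pmulrn; field.
  exact: p21.
- move=> pm pn; have p21 : p%:R ^+ 2 + 1 != 0 :> rat.
    by rewrite -natrX natr1 pnatr_eq0.
  elim: k => [|k IH]; first by rewrite mul1n muln1 expr0 divff // mul1r.
  rewrite chi_sigma2_expS // rmorphD (rmorphM _ (p%:Z ^+ 2)) (rmorphM _ (chi3 p ^+ _)).
  rewrite !rmorphXn /=.
  rewrite IH {1}/chi3 pm /=.
  rewrite [(2 * k.+2)%N]mulnS exprD -pmulrn rmorphN1 [(-1) ^+ k.+1]exprS mulN1r.
  (* Here [chi3 p = -1]; the sign is made an atom, since the identity is linear in it. *)
  move: ((-1) ^+ k) => s; field.
  exact: p21.
Qed.
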